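(* Let $A\in\mathbb{R}^{m\times p}$, $B\in\mathbb{R}^{q\times n}$ and $C\in\mathbb{R}^{m\times n}$ be such that the matrix equation $AXB=C$ has a solution $X\in\mathbb{R}^{p\times q}$. Let $X_*=A^\dagger CB^\dagger$ be its minimal Frobenius norm solution, and let $X_k$ be the $k$th approximation of $X_*$ generated by the global randomized block Kaczmarz (GRBK) method described in the context, started from a given $X_0\in\mathbb{R}^{p\times q}$. Let $\Delta$ and $\Gamma$ be the block diagonal matrices defined in the context. Then the expected norm of the error at the $k$th iteration satisfies $$\mathbb{E}\|X_k-X_*\|_F^2\le\left(1-\sigma_{\min}^2(\Delta)\,\sigma_{\min}^2(\Gamma)\,\sigma_{\min}^2(A)\,\sigma_{\min}^2(B)\right)^k\|X_0-X_*\|_F^2 .$$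
   Context: Notation: $[m]=\{1,\dots,m\}$; $\|\cdot\|_F$ is the Frobenius norm; $M^\dagger$ is the Moore–Penrose pseudoinverse; $\sigma_{\min}(M)$ denotes the smallest nonzero singular value of $M$. For index sets $I\subseteq[m]$, $J\subseteq[n]$: $A_{I,:}$ is the submatrix of $A$ formed by the rows indexed by $I$, $B_{:,J}$ is the submatrix of $B$ formed by the columns indexed by $J$, and $C_{I,J}$ is the submatrix of $C$ with rows in $I$ and columns in $J$. Sampling: the index sets $I\subseteq[m]$ that may be selected have probabilities $\mathbb{P}(I)>0$ with $\sum_I\mathbb{P}(I)=1$; the index sets $J\subseteq[n]$ that may be selected have probabilities $\mathbb{P}(J)>0$ with $\sum_J\mathbb{P}(J)=1$. GRBK method: given $X_0\in\mathbb{R}^{p\times q}$, at each iteration $k=0,1,2,\dots$ select an index set $I_k\subseteq[m]$ with probability $\mathbb{P}(I_k)$ and an index set $J_k\subseteq[n]$ with probability $\mathbb{P}(J_k)$, independently of each other and of all previous selections, and set $$X_{k+1}=X_k+A_{I_k,:}^\dagger\,(C_{I_k,J_k}-A_{I_k,:}X_kB_{:,J_k})\,B_{:,J_k}^\dagger .$$ For a matrix $M$ with singular value decomposition $M=U\Sigma V^T$, put $M^{\dagger\frac12}=V\Sigma^{\dagger\frac12}U^T$, where $\Sigma^{\dagger\frac12}$ is the diagonal matrix (of the transposed shape) with entries $\sigma_i^{-1/2}$ for the nonzero singular values $\sigma_i$ and $0$ for the zero ones. $\Delta$ is the block diagonal matrix with diagonal blocks $\mathbb{P}(I)^{\frac12}(A_{I,:}A_{I,:}^T)^{\dagger\frac12}$,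 one for each index set $I\subseteq[m]$ that may be selected; $\Gamma$ is the block diagonal matrix with diagonal blocks $\mathbb{P}(J)^{\frac12}(B_{:,J}^TB_{:,J})^{\dagger\frac12}$, one for each index set $J\subseteq[n]$ that may be selected.
   Formalization: The formal theorem additionally assumes that X_0 = A^T W B^T for some W (e.g. X_0 = 0), and that the selectable index sets I cover [m] and the selectable J cover [n]; without these the stated bound is false. The smallest nonzero singular value of a zero matrix is taken to be 0. *)

(* Defs.v *)
From mathcomp Require Import all_boot all_order all_algebra.
From mathcomp Require Import all_classical all_reals all_analysis.

Set Implicit Arguments.
Unset Strict Implicit.
Unset Printing Implicit Defensive.

Import Order.TTheory GRing.Theory Num.Theory.

Local Open Scope classical_set_scope.
Local Open Scope ring_scope.

Section Matrices.
Context {R : realType}.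

Definition frob_norm m n (M : 'M[R]_(m, n)) : R :=
  Num.sqrt (\sum_i \sum_j M i j ^+ 2).

Definition is_mpinv m n (M : 'M[R]_(m, n)) (X : 'M[R]_(n, m)) : Prop :=
  [/\ M *m X *m M = M, X *m M *m X = X,
      (M *m X)^T = M *m X & (X *m M)^T = X *m M].

(* The Penrose conditions determine [mpinv M] uniquely; the default value 0 of
   [xget] is never used. *)
Definition mpinv m n (M : 'M[R]_(m, n)) : 'M[R]_(n, m) :=
  xget 0 [set X | is_mpinv M X].

(* Full singular value decomposition M = U S V^T, with S rectangular diagonal;
   the singular values are not required to be sorted. *)
Definition is_svd m n (M : 'M[R]_(m, n))
    (U : 'M[R]_m) (S : 'M[R]_(m, n)) (V : 'M[R]_n) : Prop :=
  [/\ U^T *m U = 1%:M, V^T *m V = 1%:M,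
      forall (i : 'I_m) (j : 'I_n), i <> j :> nat -> S i j = 0,
      forall i j, 0 <= S i j & M = U *m S *m V^T].

Definition singular_value m n (M : 'M[R]_(m, n)) (s : R) : Prop :=
  exists U S V, is_svd M U S V /\
    exists (i : 'I_m) (j : 'I_n), i = j :> nat /\ S i j = s.

(* The infimum ranges over a finite set, hence is a minimum when M is nonzero;
   for M = 0 the set is empty and [inf set0 = 0]. *)
Definition sigma_min m n (M : 'M[R]_(m, n)) : R :=
  inf [set s | singular_value M s /\ 0 < s].

(* Entrywise s |-> (sqrt s)^-1 is the required operation on S^T because
   [(Num.sqrt 0)^-1 = 0]. The result does not depend on the decomposition. *)
Definition mpinv_half m n (M : 'M[R]_(m, n)) : 'M[R]_(n, m) :=
  xget 0 [set X | exists U S V, is_svd M U S V /\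
    X = V *m map_mx (fun s => (Num.sqrt s)^-1) S^T *m U^T].

Definition rows m n (A : 'M[R]_(m, n)) (I : {set 'I_m}) : 'M[R]_(#|I|, n) :=
  rowsub (@enum_val _ (mem I)) A.

Definition cols m n (B : 'M[R]_(m, n)) (J : {set 'I_n}) : 'M[R]_(m, #|J|) :=
  colsub (@enum_val _ (mem J)) B.

Definition rowscols m n (C : 'M[R]_(m, n)) (I : {set 'I_m}) (J : {set 'I_n}) :
    'M[R]_(#|I|, #|J|) :=
  mxsub (@enum_val _ (mem I)) (@enum_val _ (mem J)) C.

(* [F] is the collection of index sets that may be selected. *)
Definition sampling m (F : {set {set 'I_m}}) (pr : {set 'I_m} -> R) : Prop :=
  (forall S, S \in F -> 0 < pr S) /\ \sum_(S in F) pr S = 1.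

Definition Delta_block m p (A : 'M[R]_(m, p)) (pr : {set 'I_m} -> R)
    (I : {set 'I_m}) : 'M[R]_#|I| :=
  Num.sqrt (pr I) *: mpinv_half (rows A I *m (rows A I)^T).

Definition Delta m p (A : 'M[R]_(m, p))
    (F : {set {set 'I_m}}) (pr : {set 'I_m} -> R) :=
  \mxdiag_(i < #|F|) Delta_block A pr (enum_val i).

Definition Gamma_block q n (B : 'M[R]_(q, n)) (pr : {set 'I_n} -> R)
    (J : {set 'I_n}) : 'M[R]_#|J| :=
  Num.sqrt (pr J) *: mpinv_half ((cols B J)^T *m cols B J).

Definition Gamma q n (B : 'M[R]_(q, n))
    (G : {set {set 'I_n}}) (pr : {set 'I_n} -> R) :=
  \mxdiag_(j < #|G|) Gamma_block B pr (enum_val j).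

Fixpoint grbk m p q n (A : 'M[R]_(m, p)) (B : 'M[R]_(q, n)) (C : 'M[R]_(m, n))
    (X0 : 'M[R]_(p, q)) (I : nat -> {set 'I_m}) (J : nat -> {set 'I_n})
    (k : nat) : 'M[R]_(p, q) :=
  if k is k'.+1 then
    let X := grbk A B C X0 I J k' in
    X + mpinv (rows A (I k'))
          *m (rowscols C (I k') (J k') - rows A (I k') *m X *m cols B (J k'))
          *m mpinv (cols B (J k'))
  else X0.

End Matrices.

Section Randomness.
Context {d : measure_display} {T : measurableType d} {R : realType}.
Variable P : probability T R.

Definition has_law m (Z : T -> {set 'I_m})
    (F : {set {set 'I_m}}) (pr : {set 'I_m} -> R) : Prop :=
  (forall S, measurable (Z @^-1` [set S])) /\
  (forall S, S \in F -> P (Z @^-1` [set S]) = (pr S)%:E).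

Definition mutually_independent (K : choiceType) (E : K -> set (set T)) : Prop :=
  forall (s : seq K) (e : K -> set T), uniq s ->
    (forall k, k \in s -> E k (e k)) ->
    P (\bigcap_(k in [set` s]) e k) = (\prod_(k <- s) P (e k))%E.

(* The events determined by the k-th row selection ([inl k]) and by the k-th
   column selection ([inr k]). *)
Definition selection_events m n
    (I : nat -> T -> {set 'I_m}) (J : nat -> T -> {set 'I_n})
    (k : nat + nat) : set (set T) :=
  match k with
  | inl i => [set I i @^-1` S | S in [set: set {set 'I_m}]]
  | inr j => [set J j @^-1` S | S in [set: set {set 'I_n}]]
  end.

End Randomness.

(* Main.v *)
Require Import Defs.
From mathcomp Require Import all_boot all_order all_algebra.
From mathcomp Require Import all_classical all_reals all_analysis.
From mathcomp Require Import measurable_realfun.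
From mathcomp Require Import ring lra.

Import Order.TTheory GRing.Theory Num.Theory.
Import numFieldNormedType.Exports.

Local Open Scope classical_set_scope.
Local Open Scope ring_scope.

(* One step replaces the error E by E - P E Q, where P = A_I^+ A_I and
   Q = B_J B_J^+ are orthogonal projections, so by Pythagoras the squared norm
   drops by |P E Q|^2. As A_I x lies in the range of A_I A_I^T, one has
   |A_I^+ A_I x| = |(A_I A_I^T)^(+1/2) A_I x|, so the expectation of |P x|^2 is
   |Delta y|^2, where y stacks the vectors A_I x. All vectors involved lie in
   the row spaces on which sigma_min bounds the matrix from below, and since the
   selectable blocks cover every row, |y| >= |A x|. The same argument on the
   transposed side handles Q, and independence lets the one-step bound be
   iterated along the finitely many selection histories.

   The existence of singular value decompositions, on which sigma_min, the
   pseudoinverse and its square root all rest, follows by deflation: a maximizer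
   of |M x| on the unit sphere gives a singular pair, and Householder
   reflections split it off as a 1 x 1 block. *)

Set Implicit Arguments.
Unset Strict Implicit.
Unset Printing Implicit Defensive.

(** * Squared Frobenius norm and compactness of its unit sphere *)

Section SquaredNorm.
Context {R : realType}.

Lemma trmxZ m n a (M : 'M[R]_(m, n)) : (a *: M)^T = a *: M^T.
Proof. exact: linearZ. Qed.

Lemma trmxB m n (M N : 'M[R]_(m, n)) : (M - N)^T = M^T - N^T.
Proof. exact: linearB. Qed.

Definition sqnorm m n (M : 'M[R]_(m, n)) : R := \tr (M *m M^T).

Lemma sqnormE m n (M : 'M[R]_(m, n)) : sqnorm M = \sum_i \sum_j M i j ^+ 2.
Proof.
apply: eq_bigr => i _; rewrite mxE; apply: eq_bigr => j _.
by rewrite mxE expr2.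
Qed.

Lemma sqr_frob_norm m n (M : 'M[R]_(m, n)) : frob_norm M ^+ 2 = sqnorm M.
Proof.
rewrite /frob_norm sqnormE sqr_sqrtr// sumr_ge0// => i _.
by rewrite sumr_ge0// => j _; rewrite sqr_ge0.
Qed.

Lemma sqnorm_ge0 m n (M : 'M[R]_(m, n)) : 0 <= sqnorm M.
Proof. by rewrite -sqr_frob_norm sqr_ge0. Qed.

Lemma sqnorm_eq0 m n (M : 'M[R]_(m, n)) : sqnorm M = 0 -> M = 0.
Proof.
rewrite sqnormE => /psumr_eq0P M0; apply/matrixP => i j; rewrite mxE.
have /psumr_eq0P Mi0 : \sum_j M i j ^+ 2 = 0.
  by apply: M0 => // k _; rewrite sumr_ge0// => l _; rewrite sqr_ge0.
by apply/eqP; rewrite -sqrf_eq0 Mi0// => l _; rewrite sqr_ge0.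
Qed.

Lemma sqnorm0 m n : sqnorm (0 : 'M[R]_(m, n)) = 0.
Proof. by rewrite /sqnorm mul0mx mxtrace0. Qed.

Lemma sqnorm_tr m n (M : 'M[R]_(m, n)) : sqnorm M^T = sqnorm M.
Proof. by rewrite /sqnorm trmxK mxtrace_mulC. Qed.

Lemma sqnormZ m n a (M : 'M[R]_(m, n)) : sqnorm (a *: M) = a ^+ 2 * sqnorm M.
Proof.
by rewrite /sqnorm trmxZ -scalemxAl -scalemxAr scalerA mxtraceZ expr2.
Qed.

Lemma sqnorm_mull m n k (M : 'M[R]_(m, n)) (X : 'M[R]_(n, k)) :
  sqnorm (M *m X) = \tr (X^T *m (M^T *m M) *m X).
Proof. by rewrite /sqnorm mxtrace_mulC trmx_mul !mulmxA. Qed.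

Lemma sqnorm_orthol m n k (U : 'M[R]_(m, n)) (X : 'M[R]_(n, k)) :
  U^T *m U = 1%:M -> sqnorm (U *m X) = sqnorm X.
Proof. by move=> U1; rewrite sqnorm_mull U1 mulmx1 /sqnorm mxtrace_mulC. Qed.

Lemma sqnorm_mul_continuous n k (N : 'M[R]_(n, k)) :
  continuous (fun x : 'rV[R]_n => sqnorm (x *m N)).
Proof.
(* The limit is taken along any filter converging to [x], then specialized to [nbhs x]. *)
suff gen (x : 'rV[R]_n) (S : set_system 'rV[R]_n) : Filter S ->
    S --> x -> sqnorm (y *m N) @[y --> S] --> sqnorm (x *m N).
  by move=> x; exact: (gen x (nbhs x) (nbhs_filter x) cvg_id).
move=> FS Sx; rewrite sqnormE; under eq_fun do rewrite sqnormE.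
apply: (@cvg_big _ _ +%R) => [|i _]; first exact: add_continuous.
apply: (@cvg_big _ _ +%R) => [|j _]; first exact: add_continuous.
under eq_fun do rewrite mxE expr2.
rewrite mxE expr2.
have cvgx : \sum_l y i l * N l j @[y --> S] --> \sum_l x i l * N l j.
  apply: (@cvg_big _ _ +%R) => [|l _]; first exact: add_continuous.
  apply: cvgM; last exact: cvg_cst.
  by apply: (@continuous_cvg _ _ _ S _ id (fun y : 'rV[R]_n => y i l));
    [exact: coord_continuous|].
exact: cvgM.
Qed.

Lemma sqnorm_sphere_compact n : compact [set x : 'rV[R]_n | sqnorm x = 1].
Proof.
apply: bounded_closed_compact; last first.
  have -> : [set x : 'rV[R]_n | sqnorm x = 1] =
      (fun x : 'rV[R]_n => sqnorm (x *m 1%:M)) @^-1` [set 1].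
    by apply/seteqP; split => x /=; rewrite mulmx1.
  apply: closed_comp; last exact: closed_eq.
  by move=> x _; exact: sqnorm_mul_continuous.
exists 1; split; first exact: num_real.
move=> M ltM x /= x1; rewrite [leLHS]/Num.norm /= mx_normrE.
apply/bigmax_leP; split; first exact: le_trans ler01 (ltW ltM).
move=> [i j] _ /=; apply: le_trans (ltW ltM); rewrite -ler_sqr ?nnegrE//.
rewrite expr1n -x1 real_normK ?num_real// sqnormE (ord1 i) big_ord1.
by rewrite (bigD1 j)//= lerDl sumr_ge0// => l _; rewrite sqr_ge0.
Qed.

End SquaredNorm.

(** * Existence of singular value decompositions *)

Section SVD.
Context {R : realType}.

(** First-order optimality: a nonzero linear term would make the quadratic negative at a suitable
    [t]. *)
Lemma quadratic_ge0_linear0 (a b : R) :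
  (forall t, 0 <= t ^+ 2 * a - 2 * t * b) -> b = 0.
Proof.
move=> H; have [//|b0] := eqVneq b 0; exfalso.
have b2 : 0 < b ^+ 2 by rewrite exprn_even_gt0.
have a0 : 0 <= a.
  have := H 1; have := H (-1); rewrite expr1n sqrrN expr1n; lra.
have a1 : 0 < a + 1 by lra.
(* The minimizer is [b / a]; the shift to [a + 1] also covers [a = 0]. *)
have := H (b / (a + 1)).
have -> : (b / (a + 1)) ^+ 2 * a - 2 * (b / (a + 1)) * b =
    - (b ^+ 2 * (a + 2) / (a + 1) ^+ 2) by field; lra.
rewrite oppr_ge0 => /le_gtF/negP; apply; apply: divr_gt0.
  by apply: mulr_gt0 => //; lra.
by rewrite exprn_gt0.
Qed.

(** The maximum over the compact unit sphere is attained, and homogeneity extends the bound to every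
    [x]. *)
Lemma sqnorm_mul_max n k (N : 'M[R]_(n, k)) : N != 0 ->
  exists c : 'rV[R]_n, [/\ sqnorm c = 1, 0 < sqnorm (c *m N) &
    forall x : 'rV[R]_n, sqnorm (x *m N) <= sqnorm (c *m N) * sqnorm x].
Proof.
move=> N0.
have [x0 xN0] : exists x : 'rV[R]_n, x *m N != 0.
  apply: contrapT => H; case/negP: N0; apply/eqP/row_matrixP => i.
  rewrite row0 rowE; apply/eqP/negPn/negP => h.
  by apply: H; exists (delta_mx 0 i).
have normalize (x : 'rV[R]_n) : x != 0 ->
    exists2 s, 0 < s & sqnorm (s *: x) = 1 /\ sqnorm x = (s ^+ 2)^-1.
  move=> xn0; have sx : 0 < sqnorm x.
    rewrite lt_def sqnorm_ge0 andbT; apply: contra xn0 => /eqP /sqnorm_eq0 ->.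
    by [].
  exists (Num.sqrt (sqnorm x))^-1; first by rewrite invr_gt0 sqrtr_gt0.
  by rewrite sqnormZ exprVn sqr_sqrtr ?ltW// mulVf ?lt0r_neq0// invrK.
have x00 : x0 != 0 by apply: contra xN0 => /eqP ->; rewrite mul0mx.
have [||c] := @EVT_max_rV R n (fun x : 'rV[R]_n => sqnorm (x *m N))
    [set x : 'rV[R]_n | sqnorm x = 1] _ (@sqnorm_sphere_compact R n).
- by have [s _ [xs _]] := normalize x0 x00; exists (s *: x0).
- by apply: continuous_subspaceT => x; exact: sqnorm_mul_continuous.
rewrite inE /= => c1 cmax.
have le_c (x : 'rV[R]_n) : sqnorm (x *m N) <= sqnorm (c *m N) * sqnorm x.
  have [->|xn0] := eqVneq x 0; first by rewrite mul0mx !sqnorm0 mulr0.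
  have [s s0 [s1 ->]] := normalize x xn0.
  have := cmax (s *: x); rewrite inE /= => /(_ s1).
  rewrite -scalemxAl sqnormZ mulrC -ler_pdivlMr// exprn_gt0//.
exists c; split=> //.
rewrite lt_def sqnorm_ge0 andbT; apply: contra xN0 => /eqP c0.
apply/eqP/sqnorm_eq0/eqP; rewrite eq_le sqnorm_ge0 andbT.
by have := le_c x0; rewrite c0 mul0r.
Qed.

(** A maximizer [c] of [sqnorm (c *m M^T)] on the unit sphere yields an eigenvector [v = c^T] of
    [M^T *m M] for the maximum [l]. Then [s] is the root of [l] and u = s^-1 M v. *)
Lemma top_singular_pair m n (M : 'M[R]_(m, n)) : M != 0 ->
  exists (s : R) (u : 'cV[R]_m) (v : 'cV[R]_n),
    [/\ 0 < s, u^T *m u = 1%:M, v^T *m v = 1%:M,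
        M *m v = s *: u & M^T *m u = s *: v].
Proof.
move=> M0; have Mt0 : M^T != 0 by rewrite trmx_eq0.
have [c [c1 l0 le_l]] := sqnorm_mul_max Mt0.
set l := sqnorm (c *m M^T) in l0 le_l.
have scalar1 k (x : 'rV[R]_k) : x *m x^T = (sqnorm x)%:M.
  by rewrite [LHS]mx11_scalar /sqnorm /mxtrace big_ord1.
(* Up to a factor 2, [g] is the gradient at [c] of l |x|^2 - |x M^T|^2, which is nonnegative and
   vanishes at [c]. Moving along [- t *: g] gives a quadratic in [t] with linear coefficient -2
   |g|^2, so [g = 0]. *)
pose g := l *: c - c *m M^T *m M.
have Eg : g = 0.
  apply: sqnorm_eq0; apply:
    (@quadratic_ge0_linear0 (l * sqnorm g - sqnorm (g *m M^T))).
  move=> t; have := le_l (c - t *: g); rewrite -subr_ge0.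
  congr (0 <= _).
  have expand k (x y : 'rV[R]_k) : sqnorm (x - t *: y) =
      sqnorm x - 2 * t * \tr (x *m y^T) + t ^+ 2 * sqnorm y.
    have tC : \tr (y *m x^T) = \tr (x *m y^T).
      by rewrite -mxtrace_tr trmx_mul trmxK.
    have dT : (x - t *: y)^T = x^T - t *: y^T by rewrite trmxB trmxZ.
    rewrite /sqnorm dT mulmxBl !mulmxBr -!scalemxAl -!scalemxAr.
    rewrite !raddfB/= !mxtraceZ tC; ring.
  rewrite mulmxBl -scalemxAl !expand c1 -/l.
  have -> : sqnorm g = l * \tr (c *m g^T) - \tr (c *m M^T *m (g *m M^T)^T).
    transitivity (\tr ((l *: c - c *m M^T *m M) *m g^T)) => //.
    rewrite mulmxBl raddfB/= -scalemxAl mxtraceZ.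
    by rewrite trmx_mul trmxK !mulmxA.
  ring.
pose s := Num.sqrt l.
have s0 : 0 < s by rewrite sqrtr_gt0.
have sl : s * s = l by rewrite -expr2 sqr_sqrtr// ltW.
have sn0 : s != 0 by rewrite lt0r_neq0.
exists s, (s^-1 *: (M *m c^T)), c^T; split=> //.
- rewrite trmxZ -scalemxAl -scalemxAr scalerA trmx_mul trmxK.
  have := scalar1 _ (c *m M^T); rewrite trmx_mul trmxK -/l => ->.
  by rewrite scale_scalar_mx -sl -invfM mulVf// mulf_neq0.
- by rewrite trmxK scalar1 c1.
- by rewrite scalerA divff// scale1r.
rewrite -scalemxAr mulmxA.
have -> : M^T *m M *m c^T = l *: c^T.
  apply: trmx_inj; rewrite !trmx_mul !trmxK trmxZ trmxK mulmxA.
  by apply/eqP; rewrite eq_sym -subr_eq0 -/g Eg.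
by rewrite scalerA -sl mulrA mulVf// mul1r.
Qed.

(** The reflection in the hyperplane orthogonal to w = u - e swaps the unit vectors e and u; if u =
    e, the identity serves. *)
Lemma householder n (u : 'cV[R]_n.+1) : u^T *m u = 1%:M ->
  exists H : 'M[R]_n.+1, [/\ H^T = H, H *m H = 1%:M & H *m delta_mx 0 0 = u].
Proof.
move=> u1; pose e : 'cV[R]_n.+1 := delta_mx 0 0.
have [ue|ue] := eqVneq (u - e) 0.
  exists 1%:M; rewrite trmx1 mul1mx; split=> //; rewrite mul1mx.
  by apply/esym/eqP; rewrite -subr_eq0 ue.
set w := u - e in ue; set c := sqnorm w.
have c0 : c != 0 by apply: contra ue => /eqP/sqnorm_eq0 ->.
have ww : w^T *m w = c%:M.
  by rewrite [LHS]mx11_scalar /c -sqnorm_tr /sqnorm trmxK /mxtrace big_ord1.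
have ee : e^T *m e = 1%:M.
  by rewrite /e trmx_delta mul_delta_mx; apply/matrixP => i j; rewrite !mxE !ord1.
have ue_eu : u^T *m e = e^T *m u.
  by apply/matrixP => i j; rewrite -[e^T *m u]trmxK trmx_mul trmxK [RHS]mxE !ord1.
(* As u and e are unit vectors, |w|^2 = 2 (1 - u^T e), while w^T e = u^T e - 1. *)
have we : w^T *m e = (- (c / 2))%:M.
  have : w^T *m w = (2 : R) *: (1%:M - u^T *m e).
    rewrite /w trmxB mulmxBl !mulmxBr u1 ee -ue_eu scalerBr scaler_nat mulr2n.
    by rewrite scaler_nat mulr2n; set x := u^T *m e; rewrite opprB addrACA opprD.
  rewrite ww => /(congr1 (fun x => (- (2 : R)^-1) *: x)).
  rewrite scalerA mulNr mulVf ?pnatr_eq0// scaleN1r opprB => E.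
  by rewrite trmxB mulmxBl ee -E scale_scalar_mx mulNr mulrC.
exists (1%:M - (2 / c) *: (w *m w^T)); split.
- by rewrite trmxB trmxZ trmx1 trmx_mul trmxK.
- have -> : (1%:M - (2 / c) *: (w *m w^T)) *m (1%:M - (2 / c) *: (w *m w^T)) =
      1%:M - (2 / c + 2 / c - (2 / c) ^+ 2 * c) *: (w *m w^T).
    rewrite mulmxBl mul1mx mulmxBr mulmx1 -scalemxAl -scalemxAr scalerA.
    rewrite -(mulmxA w) (mulmxA w^T) ww mul_scalar_mx -scalemxAr scalerA -expr2.
    by rewrite !scalerBl scalerDl !opprD !opprK !addrA.
  have -> : 2 / c + 2 / c - (2 / c) ^+ 2 * c = 0 by field; rewrite c0.
  by rewrite scale0r subr0.
rewrite mulmxBl mul1mx -scalemxAl -mulmxA we mul_mx_scalar scalerA.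
have -> : 2 / c * - (c / 2) = -1 :> R by field; rewrite c0.
by rewrite scaleN1r opprK -/e /w addrCA subrr addr0.
Qed.

Lemma svd_exists m n (M : 'M[R]_(m, n)) : exists U S V, is_svd M U S V.
Proof.
elim: m n M => [|m IH] [|n] M.
- by exists 1%:M, M, 1%:M; split; rewrite ?trmx1 ?mulmx1 ?mul1mx//; case.
- by exists 1%:M, M, 1%:M; split; rewrite ?trmx1 ?mulmx1 ?mul1mx//; case.
- by exists 1%:M, M, 1%:M; split; rewrite ?trmx1 ?mulmx1 ?mul1mx// => ? [].
have [->|M0] := eqVneq M 0.
  exists 1%:M, 0, 1%:M; split; rewrite ?trmx1 ?mulmx0 ?mul0mx ?mulmx1//.
  - by move=> i j _; rewrite mxE.
  - by move=> i j; rewrite mxE.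
have [s [u [v [s0 u1 v1 Mv Mu]]]] := top_singular_pair M0.
have [H [Ht HH He]] := householder u1.
have [K [Kt KK Ke]] := householder v1.
(* [H] and [K] carry the first basis vectors to [u] and [v], so the first row and column of [N]
   vanish off the corner entry [s], and induction applies to the remaining block. *)
pose N : 'M[R]_(m.+1, n.+1) := H *m M *m K.
have Ne : N *m delta_mx 0 0 = s *: (delta_mx 0 0 : 'cV[R]_m.+1).
  by rewrite /N -!mulmxA Ke Mv -scalemxAr -He mulmxA HH mul1mx.
have Nte : N^T *m delta_mx 0 0 = s *: (delta_mx 0 0 : 'cV[R]_n.+1).
  by rewrite /N !trmx_mul Kt Ht -!mulmxA He Mu -scalemxAr -Ke mulmxA KK mul1mx.
have EM : M = H *m N *m K.
  by rewrite /N !mulmxA HH mul1mx -!mulmxA KK mulmx1.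
clearbody N.
have N0 i : N i 0 = s * (i == 0)%:R.
  by have /matrixP/(_ i 0) := Ne; rewrite -colE !mxE eqxx andbT.
have Nt0 j : N 0 j = s * (j == 0)%:R.
  by have /matrixP/(_ j 0) := Nte; rewrite -colE !mxE eqxx andbT.
have L0 k : lshift k (0 : 'I_1) = 0 :> 'I_k.+1 by exact: val_inj.
pose D : 'M[R]_(m, n) := drsubmx (N : 'M[R]_(1 + m, 1 + n)).
have EN : N = block_mx s%:M 0 0 D :> 'M[R]_(1 + m, 1 + n).
  rewrite -[LHS](@submxK _ 1 m 1 n); congr block_mx; apply/matrixP => i j;
    rewrite !mxE.
  - by rewrite !ord1 !L0 ?N0 ?eqxx ?mulr1.
  - by rewrite !ord1 !L0 ?Nt0 ?mulr0.
  - by rewrite !ord1 !L0 ?N0 ?mulr0.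
have [U [S [V [U1 V1 Soff Sge NE]]]] := IH _ D.
have orth_block k (W : 'M[R]_k) : W^T *m W = 1%:M ->
    (block_mx 1%:M 0 0 W)^T *m block_mx 1%:M 0 0 W = 1%:M :> 'M[R]_(1 + k).
  move=> W1; rewrite tr_block_mx mulmx_block !trmx0 trmx1.
  by rewrite !mul0mx !mulmx0 !addr0 add0r W1 mul1mx -scalar_mx_block.
pose BU : 'M[R]_m.+1 := block_mx 1%:M 0 0 U : 'M[R]_(1 + m).
pose BV : 'M[R]_n.+1 := block_mx 1%:M 0 0 V : 'M[R]_(1 + n).
pose BS : 'M[R]_(m.+1, n.+1) := block_mx s%:M 0 0 S : 'M[R]_(1 + m, 1 + n).
exists (H *m BU), BS, (K *m BV); split.
- by rewrite trmx_mul Ht mulmxA -(mulmxA BU^T) HH mulmx1; exact: orth_block.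
- by rewrite trmx_mul Kt mulmxA -(mulmxA BV^T) KK mulmx1; exact: orth_block.
- move=> i j; case: (@splitP 1 m i) => i' Ei; case: (@splitP 1 n j) => j' Ej ij.
  + by case: ij; rewrite Ei Ej !ord1.
  + have -> : i = lshift m i' by apply: val_inj.
    have -> : j = rshift 1 j' by apply: val_inj.
    by rewrite (@block_mxEur _ 1 m 1 n) mxE.
  + have -> : i = rshift 1 i' by apply: val_inj.
    have -> : j = lshift n j' by apply: val_inj.
    by rewrite (@block_mxEdl _ 1 m 1 n) mxE.
  + have Ei2 : i = rshift 1 i' by apply: val_inj.
    have Ej2 : j = rshift 1 j' by apply: val_inj.
    rewrite Ei2 Ej2 (@block_mxEdr _ 1 m 1 n); apply: Soff => ij'; apply: ij.
    by rewrite Ei Ej ij'.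
- move=> i j; rewrite !mxE; case: splitP => i' _; rewrite !mxE;
    case: splitP => j' _;
    rewrite ?mxE//.
  by rewrite mulrn_wge0// ltW.
rewrite EM; have -> : N = BU *m BS *m BV^T.
  rewrite EN NE /BU /BS /BV (@tr_block_mx _ 1 n 1 n) !trmx0 trmx1.
  rewrite (@mulmx_block _ 1 m 1 m 1 n) (@mulmx_block _ 1 m 1 n 1 n).
  by rewrite !mul0mx !mulmx0 !addr0 !add0r !mul1mx !mulmx1 !mul0mx.
by rewrite trmx_mul Kt !mulmxA.
Qed.

End SVD.

(** * Pseudoinverses and the lower bound by the smallest nonzero singular value *)

Section PseudoInverse.
Context {R : realType}.

(** Since [0^-1 = 0], [S *m D] is the diagonal 0/1 matrix marking the nonzero rows of [S]. *)
Lemma diagonal_pinv m n (S : 'M[R]_(m, n)) (D := map_mx GRing.inv S^T) :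
  (forall (i : 'I_m) (j : 'I_n), i <> j :> nat -> S i j = 0) ->
  S *m D *m S = S /\ (S *m D)^T = S *m D.
Proof.
move=> Soff.
have SDE i j : (S *m D) i j = ((i == j) && [exists k, S i k != 0])%:R.
  rewrite mxE; have [<-|ij] /= := eqVneq i j.
    case: existsP => [[k Sk]|H]; last first.
      rewrite big1// => l _; have [->|Sl] := eqVneq (S i l) 0;
        first by rewrite mul0r.
      by case: H; exists l.
    rewrite (bigD1 k)//= !mxE divff// big1 ?addr0// => l lk.
    rewrite Soff ?mul0r// => il; case/eqP: Sk; apply: Soff => ik.
    by case/eqP: lk; apply: val_inj; exact: etrans (esym il) ik.
  rewrite big1// => k _; rewrite !mxE.
  have [ik|/eqP ik] := eqVneq (i : nat) k; last by rewrite Soff ?mul0r.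
  by rewrite (Soff j) ?invr0 ?mulr0// -ik => /val_inj ji; rewrite ji eqxx in ij.
split; last first.
  apply/matrixP => i j; rewrite mxE !SDE eq_sym.
  by case: eqVneq => [->|].
apply/matrixP => i j; rewrite mxE (bigD1 i)//= SDE eqxx /= big1 ?addr0.
  case: existsP => [_|H]; rewrite ?mul1r// mul0r.
  by apply/esym/eqP/negPn/negP => h; apply: H; exists j.
by move=> k ki; rewrite SDE eq_sym (negbTE ki) mul0r.
Qed.

(** [xgetPex] asks for one witness: for M = U S V^T it is V D U^T, with [D] the entrywise inverse of
    [S^T]. *)
Lemma mpinvP m n (M : 'M[R]_(m, n)) : is_mpinv M (mpinv M).
Proof.
rewrite /mpinv; apply: (@xgetPex _ 0 [set X | is_mpinv M X]).
have [U [S [V [U1 V1 Soff Sge ->]]]] := svd_exists M.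
pose D := map_mx GRing.inv S^T.
have [SDS SD_sym] := diagonal_pinv Soff.
(* [D] is rectangular diagonal too, and inverting it gives back [S], whence the other two Penrose
   equations. *)
have [|] := @diagonal_pinv _ _ D.
  by move=> i j ij; rewrite !mxE Soff ?invr0// => /esym.
have -> : map_mx GRing.inv D^T = S by apply/matrixP => i j; rewrite !mxE invrK.
rewrite -/D in SDS SD_sym; move=> DSD DS_sym.
exists (V *m D *m U^T); rewrite /is_mpinv /=.
have E1 : U *m S *m V^T *m (V *m D *m U^T) = U *m (S *m D) *m U^T.
  by rewrite !mulmxA -(mulmxA (U *m S) V^T) V1 mulmx1.
have E2 : V *m D *m U^T *m (U *m S *m V^T) = V *m (D *m S) *m V^T.
  by rewrite !mulmxA -(mulmxA (V *m D) U^T) U1 mulmx1.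
split.
- rewrite E1 !mulmxA -(mulmxA _ U^T U) U1 mulmx1 -(mulmxA U S D).
  by rewrite -(mulmxA U _ S) SDS.
- rewrite E2 !mulmxA -(mulmxA _ V^T V) V1 mulmx1 -(mulmxA V D S).
  by rewrite -(mulmxA V _ D) DSD.
- by rewrite E1 !trmx_mul trmxK -[D^T *m S^T]trmx_mul SD_sym mulmxA.
- by rewrite E2 !trmx_mul trmxK -[S^T *m D^T]trmx_mul DS_sym mulmxA.
Qed.

Lemma is_mpinv_tr m n (M : 'M[R]_(m, n)) X : is_mpinv M X -> is_mpinv M^T X^T.
Proof.
move=> [M1 M2 M3 M4]; split.
- by rewrite -!trmx_mul mulmxA M1.
- by rewrite -!trmx_mul mulmxA M2.
- by rewrite -!trmx_mul M4.
- by rewrite -!trmx_mul M3.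
Qed.

Lemma singular_value_tr m n (M : 'M[R]_(m, n)) s :
  singular_value M s -> singular_value M^T s.
Proof.
move=> [U [S [V [[U1 V1 Soff Sge ->] [i [j [ij Sij]]]]]]].
exists V, S^T, U; split; last by exists j, i; rewrite mxE.
split=> //.
- by move=> k l kl; rewrite mxE Soff// => /esym.
- by move=> k l; rewrite mxE.
- by rewrite !trmx_mul trmxK mulmxA.
Qed.

Lemma sigma_min_tr m n (M : 'M[R]_(m, n)) : sigma_min M^T = sigma_min M.
Proof.
rewrite /sigma_min; congr inf; apply/seteqP; split => s /= [Ms s0]; split=> //.
  by rewrite -[M]trmxK; exact: singular_value_tr.
exact: singular_value_tr.
Qed.

Lemma sigma_min_ge0 m n (M : 'M[R]_(m, n)) : 0 <= sigma_min M.
Proof.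
rewrite /sigma_min; set S := [set s | _].
have [->|/set0P S0] := eqVneq S set0; first by rewrite inf0.
by apply: lb_le_inf => // s [_ /ltW].
Qed.

(** In singular coordinates [M^T *m W] becomes y = S^T (U^T W). Its coordinates at zero columns of
    [S] vanish, and [S] stretches the others by at least [sigma_min M]. *)
Lemma sigma_min_le_sqnorm m n k (M : 'M[R]_(m, n)) (W : 'M[R]_(m, k)) :
  sigma_min M ^+ 2 * sqnorm (M^T *m W) <= sqnorm (M *m (M^T *m W)).
Proof.
have [U [S [V svdM]]] := svd_exists M.
have [U1 V1 Soff Sge EM] := svdM.
pose y := S^T *m (U^T *m W).
have Ex : M^T *m W = V *m y by rewrite {1}EM !trmx_mul trmxK !mulmxA.
have -> : sqnorm (M *m (M^T *m W)) = sqnorm (S *m y).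
  by rewrite Ex {1}EM -!mulmxA (mulmxA V^T) V1 mul1mx sqnorm_orthol.
rewrite Ex sqnorm_orthol// !sqnormE exchange_big [leRHS]exchange_big /=.
rewrite mulr_sumr; apply: ler_sum => l _; rewrite mulr_sumr.
have inf_le i j : S i j != 0 -> sigma_min M <= S i j.
  move=> Sij; have ij : i = j :> nat.
    by apply: contrapT => /Soff/eqP; rewrite (negbTE Sij).
  apply: ge_inf; first by exists 0 => s [_ /ltW].
  by split; [exists U, S, V; split=> //; exists i, j|rewrite lt_def Sij Sge].
have colS0 j : (forall i, S i j = 0) -> y j l = 0.
  by move=> H; rewrite mxE big1// => i _; rewrite mxE H mul0r.
pose f (i : 'I_m) (j : 'I_n) := S i j ^+ 2 * y j l ^+ 2.
(* Each row of [S] has at most one nonzero entry, so squaring leaves no cross terms. *)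
have -> : \sum_i (S *m y) i l ^+ 2 = \sum_j \sum_i f i j.
  rewrite [RHS]exchange_big; apply: eq_bigr => i _ /=; rewrite mxE.
  have [j|] := pickP (fun j : 'I_n => (i : nat) == j).
    move=> /eqP ij.
    have off j' : j' != j -> S i j' = 0.
      by move=> jj; rewrite Soff// ij => /val_inj jj'; rewrite jj' eqxx in jj.
    rewrite (bigD1 j)//= big1 ?addr0; last by move=> j' /off ->; rewrite mul0r.
    rewrite (bigD1 j)//= big1 ?addr0 /f ?exprMn//.
    by move=> j' /off ->; rewrite expr0n mul0r.
  move=> H; rewrite !big1 ?expr0n// => j _; rewrite /f Soff ?expr0n ?mul0r//;
  by apply/eqP; rewrite H.
apply: ler_sum => j _; rewrite /f -mulr_suml.
have [[i Sij]|H] := pselect (exists i, S i j != 0); last first.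
  rewrite colS0 ?expr0n ?mulr0// => i; apply/eqP/negPn/negP => h.
  by apply: H; exists i.
apply: ler_wpM2r; first exact: sqr_ge0.
apply: (@le_trans _ _ (S i j ^+ 2)).
  by rewrite ler_sqr ?nnegrE ?sigma_min_ge0//; exact: inf_le.
by rewrite (bigD1 i)//= lerDl sumr_ge0// => i' _; exact: sqr_ge0.
Qed.

End PseudoInverse.

(** * The square root of the pseudoinverse of a Gram matrix *)

Section PseudoSquareRoot.
Context {R : realType}.

(* With X = P - Q, cyclicity of the trace gives
   tr (X (P + Q) X) = tr ((P Q - Q P) X) = 0, whence P X = Q X = 0. *)
Lemma gram_sqrt_unique n k l (K : 'M[R]_(n, k)) (L : 'M[R]_(n, l))
    (P := K *m K^T) (Q := L *m L^T) : P *m P = Q *m Q -> P = Q.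
Proof.
move=> PQ; pose X := P - Q.
have Pt : P^T = P by rewrite /P trmx_mul trmxK.
have Qt : Q^T = Q by rewrite /Q trmx_mul trmxK.
have Xt : X^T = X by rewrite trmxB Pt Qt.
have sum0 : \tr (X *m P *m X) + \tr (X *m Q *m X) = 0.
  rewrite -mxtraceD -mulmxDl -mulmxDr.
  have -> : X *m (P + Q) = P *m Q - Q *m P.
    by rewrite mulmxDr /X !mulmxBl PQ addrC addrA subrK.
  have PQP : \tr (P *m Q *m P) = \tr (Q *m P *m P).
    by rewrite -mulmxA mxtrace_mulC.
  have QPQ : \tr (Q *m P *m Q) = \tr (P *m Q *m Q).
    by rewrite -mulmxA mxtrace_mulC.
  by rewrite mulmxBl /X !mulmxBr !raddfB/= PQP QPQ; ring.
have gram_tr j (G : 'M[R]_(n, j)) : \tr (X *m (G *m G^T) *m X) = sqnorm (G^T *m X).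
  by rewrite sqnorm_mull Xt trmxK.
move: sum0; rewrite !gram_tr => /eqP; rewrite paddr_eq0 ?sqnorm_ge0//.
move=> /andP[/eqP/sqnorm_eq0 KX /eqP/sqnorm_eq0 LX].
apply/eqP; rewrite -subr_eq0; apply/eqP/sqnorm_eq0.
rewrite -/X /sqnorm Xt {1}/X mulmxBl /P /Q -!mulmxA KX LX !mulmx0 subrr.
exact: mxtrace0.
Qed.

(** In an SVD of M = N N^T, H^T H = U S^+ U^T is a generalized inverse of M. Since N = M K^T, both
    claims reduce to diagonal calculus. The first one later puts the stacked vectors in the range on
    which [sigma_min] bounds [Delta]. *)
Lemma mpinv_half_gram r p (N : 'M[R]_(r, p)) (K : 'M[R]_(p, r))
    (H := mpinv_half (N *m N^T)) : is_mpinv N K ->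
  (exists W, N = H^T *m W) /\ N^T *m (H^T *m H) *m N = K *m N.
Proof.
move=> [NKN KNK NKt KNt]; pose M := N *m N^T.
have [U [S [V [[U1 V1 Soff Sge EM] EH]]]] : exists U S V, is_svd M U S V /\
    H = V *m map_mx (fun s => (Num.sqrt s)^-1) S^T *m U^T.
  apply: (@xgetPex _ 0 [set X | exists U S V, is_svd M U S V /\
    X = V *m map_mx (fun s => (Num.sqrt s)^-1) S^T *m U^T]).
  by have [U [S [V svdM]]] := svd_exists M; eexists; exists U, S, V; split.
pose s := \row_i S i i.
have ES : S = diag_mx s.
  apply/matrixP => i j; rewrite !mxE; have [->|ij] := eqVneq i j.
    by rewrite mulr1n.
  by rewrite mulr0n Soff// => /val_inj /eqP; exact/negP.
pose D f := diag_mx (\row_i f (S i i) : 'rV[R]_r).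
have DD f g h : (forall x, 0 <= x -> f x * g x = h x) -> D f *m D g = D h.
  by move=> fgh; rewrite /D mulmx_diag; congr diag_mx; apply/rowP => i; rewrite !mxE fgh.
pose rt (x : R) := Num.sqrt x.
pose irt (x : R) := (Num.sqrt x)^-1.
have {}ES : S = D id by rewrite ES; congr diag_mx; apply/rowP => i; rewrite !mxE.
have Dt f : (D f)^T = D f by exact: tr_diag_mx.
have EE : map_mx irt S^T = D irt.
  rewrite {1}ES Dt; apply/matrixP => i j; rewrite !mxE; case: eqP => _.
    by rewrite !mulr1n.
  by rewrite !mulr0n /irt sqrtr0 invr0.
rewrite -/irt EE in EH.
have Mt : M^T = M by rewrite /M trmx_mul trmxK.
have UU : U *m U^T = 1%:M by apply: mulmx1C.
have VV : V *m V^T = 1%:M by apply: mulmx1C.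
(* [U] and [V] can differ even for symmetric [M]. Still, M and U S U^T are Gram matrices whose
   squares both equal U S^2 U^T, so they agree. *)
have EM' : M = U *m D id *m U^T.
  have -> : U *m D id *m U^T = (U *m D rt) *m (U *m D rt)^T.
    rewrite trmx_mul Dt !mulmxA -(mulmxA U (D rt)) (DD rt rt id)//.
    by move=> x x0; rewrite /rt -expr2 sqr_sqrtr.
  apply: gram_sqrt_unique; rewrite -/M.
  have -> : (U *m D rt) *m (U *m D rt)^T = U *m S *m U^T.
    rewrite ES trmx_mul Dt !mulmxA -(mulmxA U (D rt)) (DD rt rt id)//.
    by move=> x x0; rewrite /rt -expr2 sqr_sqrtr.
  rewrite -{2}Mt {1 2}EM !trmx_mul trmxK ES Dt.
  rewrite !mulmxA -(mulmxA _ V^T V) V1 mulmx1.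
  by rewrite -(mulmxA (U *m D id) U^T U) U1 mulmx1.
have HtH : H^T *m H = U *m D GRing.inv *m U^T.
  rewrite EH !trmx_mul trmxK Dt !mulmxA -(mulmxA _ V^T V) V1 mulmx1.
  rewrite -(mulmxA U (D irt)) (DD irt irt GRing.inv)// => x x0.
  by rewrite -invfM -expr2 sqr_sqrtr.
have UDU f g h : (forall x, 0 <= x -> f x * g x = h x) ->
    U *m D f *m U^T *m (U *m D g *m U^T) = U *m D h *m U^T.
  move=> fgh; rewrite !mulmxA -(mulmxA _ U^T U) U1 mulmx1.
  by rewrite -(mulmxA U (D f)) (DD f g h).
have EN : N = M *m K^T.
  by rewrite -{1}NKN -mulmxA -KNt trmx_mul mulmxA.
split.
  (* Multiplied by H^T = U S^(+1/2) V^T this gives U S U^T K^T = N; zero singular values contribute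
     0 on both sides. *)
  exists (V *m D (fun x => rt x * x) *m U^T *m K^T).
  rewrite {1}EN EM' EH !trmx_mul trmxK Dt !mulmxA -(mulmxA _ V^T V) V1 mulmx1.
  rewrite -(mulmxA U (D irt)) (DD irt _ id)// => x x0.
  have [->|xn0] := eqVneq x 0; first by rewrite !mulr0.
  by rewrite mulrA mulVf ?mul1r// sqrtr_eq0 -ltNge lt_def xn0.
have MGM : M *m (H^T *m H) *m M = M.
  rewrite HtH EM' (UDU id GRing.inv (fun x => x / x))// (UDU _ id id)// => x x0.
  by have [->|xn0] := eqVneq x 0; rewrite ?mulr0// divff// mul1r.
have ENt : N^T = K *m M by rewrite {1}EN trmx_mul trmxK Mt.
rewrite {2}EN ENt.
have -> : K *m M *m (H^T *m H) *m (M *m K^T) = K *m (M *m (H^T *m H) *m M) *m K^T.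
  by rewrite !mulmxA.
by rewrite MGM -mulmxA -EN.
Qed.

(** [K *m N] is a symmetric idempotent, so both sides equal [\tr (x^T *m (K *m N) *m x)]. *)
Lemma sqnorm_mpinv_half r p k (N : 'M[R]_(r, p)) (K : 'M[R]_(p, r))
    (x : 'M[R]_(p, k)) : is_mpinv N K ->
  sqnorm (mpinv_half (N *m N^T) *m (N *m x)) = sqnorm (K *m N *m x).
Proof.
move=> NK; have [_ E] := mpinv_half_gram NK; have [_ KNK _ KNt] := NK.
have KNKN : K *m N *m (K *m N) = K *m N by rewrite mulmxA KNK.
by rewrite mulmxA !sqnorm_mull KNt KNKN -E trmx_mul !mulmxA.
Qed.

End PseudoSquareRoot.

(** * Expected effect of the sampled projections *)

Section SampledProjections.
Context {R : realType}.

Lemma rowsE m p (A : 'M[R]_(m, p)) (S : {set 'I_m}) (i : 'I_#|S|) (j : 'I_p) :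
  rows A S i j = A (enum_val i) j.
Proof. by rewrite mxE. Qed.

Lemma rows_mul m p k (A : 'M[R]_(m, p)) (X : 'M[R]_(p, k)) S :
  rows A S *m X = rows (A *m X) S.
Proof. by rewrite /rows mul_rowsub_mx. Qed.

Lemma sqnorm_rows m p (A : 'M[R]_(m, p)) (S : {set 'I_m}) :
  sqnorm (rows A S) = \sum_(i in S) \sum_j A i j ^+ 2.
Proof.
rewrite sqnormE [RHS]big_enum_val.
by apply: eq_bigr => i _; apply: eq_bigr => j _; rewrite rowsE.
Qed.

(** Exchanging the sums counts row [i] once for each set of [F] containing it, hence at least
    once. *)
Lemma sqnorm_le_sum_rows m p (A : 'M[R]_(m, p)) (F : {set {set 'I_m}}) :
  (forall i : 'I_m, exists2 S, S \in F & i \in S) ->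
  sqnorm A <= \sum_(S in F) sqnorm (rows A S).
Proof.
move=> cover; under eq_bigr do rewrite sqnorm_rows big_mkcond/=.
rewrite exchange_big sqnormE/=; apply: ler_sum => i _.
have [S SF iS] := cover i.
have ge0 : 0 <= \sum_j A i j ^+ 2 by apply: sumr_ge0 => j _; exact: sqr_ge0.
rewrite (bigD1 S)//= iS lerDl; apply: sumr_ge0 => S' _.
by case: ifP.
Qed.

Lemma sqnorm_mxcol k p (p_ : 'I_p -> nat) (Y : forall i, 'M[R]_(p_ i, k)) :
  sqnorm (\mxcol_i Y i) = \sum_i sqnorm (Y i).
Proof.
rewrite /sqnorm mxtrace_mulC tr_mxcol mul_mxrow_mxcol raddf_sum/=.
by apply: eq_bigr => i _; rewrite mxtrace_mulC.
Qed.

(** The weighted sum is |Delta Y|^2, with [Y] the stack of the blocks A_S x. It is bounded below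
    through |Y|, then |A x| by covering, then |x|. The pseudoinverses [K] are a parameter so that
    transposed ones can be supplied for the column side. *)
Lemma sum_sqnorm_proj_ge m p k (A : 'M[R]_(m, p)) (F : {set {set 'I_m}})
    (pr : {set 'I_m} -> R) (K : forall S : {set 'I_m}, 'M[R]_(p, #|S|))
    (W : 'M[R]_(m, k)) :
  sampling F pr -> (forall i : 'I_m, exists2 S, S \in F & i \in S) ->
  (forall S, is_mpinv (rows A S) (K S)) ->
  sigma_min (Delta A F pr) ^+ 2 * sigma_min A ^+ 2 * sqnorm (A^T *m W) <=
  \sum_(S in F) pr S * sqnorm (K S *m rows A S *m (A^T *m W)).
Proof.
move=> [pr_gt0 _] cover Kinv; set x := A^T *m W.
pose Y (i : 'I_#|F|) := rows A (enum_val i) *m x.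
(* Positive probabilities allow division by their roots, which puts each block of [Y] in the range
   of the transposed block of [Delta]; [cid] makes [Z] a function of [i]. *)
have Z_ex i : {Z | Y i = (Delta_block A pr (enum_val i))^T *m Z}.
  apply: cid; have [[W' EN] _] := mpinv_half_gram (Kinv (enum_val i)).
  exists ((Num.sqrt (pr (enum_val i)))^-1 *: (W' *m x)).
  rewrite /Y {1}EN /Delta_block trmxZ -scalemxAl -scalemxAr scalerA -(mulmxA _ W').
  by rewrite divff ?scale1r ?gt_eqF ?sqrtr_gt0 ?pr_gt0 ?enum_valP.
pose Z i := sval (Z_ex i).
have EY : \mxcol_i Y i = (Delta A F pr)^T *m \mxcol_i Z i.
  rewrite /Delta tr_mxdiag mul_mxdiag_mxcol; apply: eq_mxcol => i.
  exact: svalP (Z_ex i).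
have := sigma_min_le_sqnorm (Delta A F pr) (\mxcol_i Z i).
rewrite -EY /Delta mul_mxdiag_mxcol !sqnorm_mxcol -/(Delta A F pr) => DY.
rewrite [leRHS]big_enum_val /=.
have -> : \sum_(i < #|F|) pr (enum_val i) *
      sqnorm (K (enum_val i) *m rows A (enum_val i) *m x) =
    \sum_i sqnorm (Delta_block A pr (enum_val i) *m Y i).
  apply: eq_bigr => i _; rewrite /Delta_block -scalemxAl sqnormZ.
  rewrite (sqnorm_mpinv_half _ (Kinv _)) sqr_sqrtr// ltW//.
  by rewrite pr_gt0// enum_valP.
apply: le_trans DY; rewrite -mulrA; apply: ler_wpM2l; first exact: sqr_ge0.
apply: le_trans (sigma_min_le_sqnorm _ _) _.
apply: le_trans (sqnorm_le_sum_rows _ cover) _.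
rewrite big_enum_val/=; apply: ler_sum => i _.
by rewrite /Y rows_mul.
Qed.

Lemma tr_cols q n (B : 'M[R]_(q, n)) J : (cols B J)^T = rows B^T J.
Proof. by rewrite /cols /rows trmx_mxsub. Qed.

(** Reduces the column side to the row side for [B^T]. *)
Lemma Gamma_tr q n (B : 'M[R]_(q, n)) (G : {set {set 'I_n}}) pr :
  Gamma B G pr = Delta B^T G pr.
Proof.
apply: eq_mxdiag => j; rewrite /Gamma_block /Delta_block.
by rewrite -tr_cols trmxK.
Qed.

(** * One step of the error recursion *)

Section Step.
Context {m p q n : nat} (A : 'M[R]_(m, p)) (B : 'M[R]_(q, n)).

Definition error_step (E : 'M[R]_(p, q)) (s : {set 'I_m} * {set 'I_n}) :=
  E - mpinv (rows A s.1) *m rows A s.1 *m E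
      *m (cols B s.2 *m mpinv (cols B s.2)).

Definition rate F G prI prJ : R :=
  sigma_min (Delta A F prI) ^+ 2 * sigma_min (Gamma B G prJ) ^+ 2
    * sigma_min A ^+ 2 * sigma_min B ^+ 2.

(** Pythagoras: with Y = P E Q, symmetry and idempotence of P and Q give
    [\tr (E *m Y^T) = sqnorm Y]. *)
Lemma sqnorm_error_step E s : sqnorm (error_step E s) =
  sqnorm E - sqnorm (mpinv (rows A s.1) *m rows A s.1
    *m (E *m (cols B s.2 *m mpinv (cols B s.2)))).
Proof.
have [_ KNK _ KNt] := mpinvP (rows A s.1).
have [LML _ LMt _] := mpinvP (cols B s.2).
rewrite /error_step; set P := _ *m rows A s.1 in KNK KNt *.
set Q := cols B s.2 *m _ in LML LMt *.
have PP : P *m P = P by rewrite {2}/P mulmxA KNK.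
have QQ : Q *m Q = Q by rewrite {2}/Q mulmxA LML.
clearbody P Q.
pose Y := P *m E *m Q.
have cross : \tr (E *m Y^T) = sqnorm Y.
  rewrite /sqnorm /Y !trmx_mul KNt LMt !mulmxA -(mulmxA (P *m E) Q Q) QQ.
  by rewrite [RHS]mxtrace_mulC !mulmxA PP [LHS]mxtrace_mulC !mulmxA.
have crossT : \tr (Y *m E^T) = sqnorm Y.
  by rewrite -mxtrace_tr trmx_mul trmxK.
rewrite mulmxA -/Y {1}/sqnorm trmxB mulmxBl !mulmxBr !raddfB/= cross crossT.
by rewrite /sqnorm; ring.
Qed.

Lemma rows_sel m' p' (M : 'M[R]_(m', p')) S : rows M S = rows 1%:M S *m M.
Proof. by rewrite rows_mul mul1mx. Qed.

(** Symmetry rewrites the two projections as A^T Z and Z' B^T, so a step never leaves the space on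
    which the singular value bounds hold. *)
Lemma error_step_range W s : exists W',
  error_step (A^T *m W *m B^T) s = A^T *m W' *m B^T.
Proof.
have [_ _ _ KNt] := mpinvP (rows A s.1).
have [_ _ LMt _] := mpinvP (cols B s.2).
have EP : mpinv (rows A s.1) *m rows A s.1 =
    A^T *m ((rows 1%:M s.1)^T *m (mpinv (rows A s.1))^T).
  by rewrite -KNt trmx_mul {1}rows_sel trmx_mul mulmxA.
have EQ : cols B s.2 *m mpinv (cols B s.2) =
    (mpinv (cols B s.2))^T *m rows 1%:M s.2 *m B^T.
  by rewrite -LMt trmx_mul tr_cols {1}rows_sel mulmxA.
rewrite /error_step EP EQ.
set Z := (rows 1%:M s.1)^T *m _; set Z' := _ *m rows 1%:M s.2.
exists (W - Z *m (A^T *m W *m B^T) *m Z').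
by rewrite mulmxBr mulmxBl !mulmxA.
Qed.

Lemma expected_error_step F prI G prJ W (E := A^T *m W *m B^T) :
  sampling F prI -> sampling G prJ ->
  (forall i : 'I_m, exists2 S, S \in F & i \in S) ->
  (forall j : 'I_n, exists2 S, S \in G & j \in S) ->
  \sum_(S in F) \sum_(S' in G)
    prI S * prJ S' * sqnorm (error_step E (S, S')) <=
  (1 - rate F G prI prJ) * sqnorm E.
Proof.
move=> hI hJ coverI coverJ.
pose Q S' := cols B S' *m mpinv (cols B S').
pose P S := mpinv (rows A S) *m rows A S.
have -> : \sum_(S in F) \sum_(S' in G)
      prI S * prJ S' * sqnorm (error_step E (S, S')) =
    sqnorm E - \sum_(S' in G) prJ S' *
      \sum_(S in F) prI S * sqnorm (P S *m (E *m Q S')).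
  under [X in _ - X]eq_bigr do rewrite mulr_sumr.
  rewrite [X in _ - X]exchange_big/=.
  have {1}-> : sqnorm E = \sum_(S in F) \sum_(S' in G) prI S * prJ S' * sqnorm E.
    under eq_bigr do rewrite -mulr_suml -mulr_sumr hJ.2 mulr1.
    by rewrite -mulr_suml hI.2 mul1r.
  rewrite -sumrB; apply: eq_bigr => S _; rewrite -sumrB; apply: eq_bigr => S' _.
  by rewrite sqnorm_error_step /= -/(P S) -/(Q S'); ring.
rewrite mulrBl mul1r lerD2l lerN2.
pose a := sigma_min (Delta A F prI) ^+ 2 * sigma_min A ^+ 2.
pose b := sigma_min (Gamma B G prJ) ^+ 2 * sigma_min B ^+ 2.
have -> : rate F G prI prJ = a * b by rewrite /rate /a /b; ring.
(* Row side first, for fixed [S']: [E *m Q S'] is [A^T] times a matrix, so averaging over [S] gives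
   at least [a * sqnorm (E *m Q S')]. *)
apply: (@le_trans _ _ (\sum_(S' in G) prJ S' * (a * sqnorm (E *m Q S')))); last first.
  apply: ler_sum => S' S'G; apply: ler_wpM2l; first exact/ltW/hJ.1.
  rewrite /E -!(mulmxA A^T); apply: sum_sqnorm_proj_ge => // S.
  exact: mpinvP.
have -> : \sum_(S' in G) prJ S' * (a * sqnorm (E *m Q S')) =
    a * \sum_(S' in G) prJ S' * sqnorm (E *m Q S').
  by rewrite mulr_sumr; apply: eq_bigr => S' _; ring.
rewrite -mulrA; apply: ler_wpM2l; first by rewrite mulr_ge0// sqr_ge0.
have Linv S' : is_mpinv (rows B^T S') (mpinv (cols B S'))^T.
  by rewrite -tr_cols; apply: is_mpinv_tr; exact: mpinvP.
(* Column side, transposed: E^T = B (W^T A), and |E Q| = |Q^T E^T|. *)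
have := sum_sqnorm_proj_ge (W^T *m A) hJ coverJ Linv.
rewrite -Gamma_tr sigma_min_tr -/b trmxK.
have -> : B *m (W^T *m A) = E^T by rewrite /E !trmx_mul !trmxK.
rewrite sqnorm_tr => /le_trans; apply; apply: ler_sum => S' _.
by rewrite -tr_cols -trmx_mul -trmx_mul sqnorm_tr.
Qed.

End Step.
End SampledProjections.

(** * Finite selection histories *)

Section Histories.
Context {R : realType} {X : finType}.

(** Entries are appended at the end, so the newest one is the last step that [foldl] applies. *)
Fixpoint histories k : seq (seq X) :=
  if k is k'.+1
  then [seq rcons h x | h <- histories k', x <- enum X]
  else [:: [::]].

Lemma histories_uniq k : uniq (histories k).
Proof.
elim: k => //= k IH; apply: allpairs_uniq => //; first exact: enum_uniq.
by move=> [h x] [h' x'] _ _ /= /rcons_inj [-> ->].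
Qed.

Lemma mem_histories k (f : nat -> X) : mkseq f k \in histories k.
Proof.
elim: k => //= k IH; rewrite mkseqS; apply: allpairs_f => //.
exact: mem_enum.
Qed.

Lemma size_histories k h : h \in histories k -> size h = k.
Proof.
elim: k h => [|k IH] h /=; first by rewrite inE => /eqP ->.
by move=> /allpairsP[[h' x] /= [/IH <- _ ->]]; rewrite size_rcons.
Qed.

(** Every state reached from [v] is [good], so summing over the last entry first gains a factor [c];
    induction treats the shorter histories. *)
Lemma sum_histories_contraction (V : Type) (good : V -> Prop)
    (step : V -> X -> V) (w : X -> R) (Phi : V -> R) (c : R) (v : V) k :
  0 <= c -> (forall x, 0 <= w x) ->
  (forall v x, good v -> good (step v x)) ->
  (forall v, good v -> \sum_x w x * Phi (step v x) <= c * Phi v) -> good v ->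
  \sum_(h <- histories k) (\prod_(x <- h) w x) * Phi (foldl step v h)
    <= c ^+ k * Phi v.
Proof.
move=> c0 w0 good_step contr gv.
have good_foldl h : good (foldl step v h).
  elim/last_ind: h => //= h x IH; rewrite foldl_rcons; exact: good_step.
elim: k => [|k IH]; first by rewrite big_seq1 big_nil expr0.
rewrite /= big_allpairs_dep exprS -mulrA; apply: le_trans (ler_wpM2l c0 IH).
rewrite mulr_sumr; apply: ler_sum => h _; rewrite mulrCA big_enum /=.
have -> : \sum_x (\prod_(y <- rcons h x) w y) * Phi (foldl step v (rcons h x)) =
    (\prod_(y <- h) w y) * \sum_x w x * Phi (step (foldl step v h) x).
  rewrite mulr_sumr; apply: eq_bigr => x _.
  by rewrite foldl_rcons -cats1 big_cat big_seq1 mulrA.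
by apply: ler_wpM2l; [apply: prodr_ge0|exact: contr].
Qed.

End Histories.

(** * Expectations of finitely valued variables *)

Section FiniteLaws.
Context {d : measure_display} {T : measurableType d} {R : realType}.
Context (P : probability T R).

Lemma expectation_finite (X : eqType) (Z : T -> X) (s : seq X) (g : X -> R) :
  uniq s -> (forall w, Z w \in s) ->
  (forall x, x \in s -> measurable (Z @^-1` [set x])) -> (forall x, 0 <= g x) ->
  ('E_P[fun w => g (Z w)] = \sum_(x <- s) (g x)%:E * P (Z @^-1` [set x]))%E.
Proof.
move=> us Zs mZ g0; rewrite unlock.
(* The factor [(x \in s)%:R] makes [f x] measurable for every [x], the fibres being assumed
   measurable only for [x \in s]. *)
pose f x w : \bar R := ((x \in s)%:R * g x * \1_(Z @^-1` [set x]) w)%:E.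
transitivity (\int[P]_w (\sum_(x <- s) f x w))%E.
  apply: eq_integral => w _; rewrite (bigD1_seq (Z w))//= /f Zs mul1r.
  rewrite indicE mem_set// mulr1 big1 ?adde0// => x /eqP xZ.
  by rewrite indicE memNset ?mulr0// => /= Zx; apply: xZ.
rewrite ge0_integral_sum//; last 2 first.
- move=> x; rewrite /f; case: (boolP (x \in s)) => xs; last first.
    under eq_fun do rewrite !mul0r; exact: measurable_cst.
  apply/measurable_EFinP; apply: measurable_funM; first exact: measurable_cst.
  by apply: measurable_indic; exact: mZ.
- by move=> x w _; rewrite /f lee_fin !mulr_ge0// ler0n.
apply: eq_big_seq => x xs; rewrite /f xs.
under eq_integral do rewrite mul1r EFinM.
rewrite ge0_integralZl_EFin//; last first.
- by apply/measurable_EFinP; apply: measurable_indic; exact: mZ.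
by rewrite (integral_indic P measurableT (mZ x xs)) setIT.
Qed.

(** The sets in [F] already carry total mass 1, so every other set has probability 0. *)
Lemma has_law_weight m (Z : T -> {set 'I_m}) (F : {set {set 'I_m}})
    (pr : {set 'I_m} -> R) : sampling F pr -> has_law P Z F pr ->
  forall S, P (Z @^-1` [set S]) = (if S \in F then pr S else 0)%:E.
Proof.
move=> [pr0 pr1] [mZ lawZ] S; case: ifPn => [|SF]; first exact: lawZ.
pose r S := fine (P (Z @^-1` [set S])).
have Pr S' : P (Z @^-1` [set S']) = (r S')%:E.
  by rewrite /r fineK//; exact: fin_num_measure.
have r_ge0 S' : 0 <= r S' by rewrite fine_ge0.
have sum_r : 1 = \sum_S' r S'.
  have := @expectation_finite _ Z (index_enum _) (fun=> 1) (index_enum_uniq _).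
  rewrite (expectation_cst P 1) => /(_ (fun _ => mem_index_enum _) (fun x _ => mZ x)
    (fun _ => ler01)).
  under eq_bigr do rewrite mul1e Pr.
  by rewrite sumEFin => -[].
have rF : \sum_(S' in F) r S' = 1.
  by rewrite -pr1; apply: eq_bigr => S' S'F; rewrite /r lawZ.
have /psumr_eq0P r0 : \sum_(S' | S' \notin F) r S' = 0.
  by move: sum_r; rewrite (bigID (mem F))/= rF => sum_r; lra.
by rewrite Pr r0.
Qed.

End FiniteLaws.

(** * Probability of a selection history *)

Section Selections.
Context {d : measure_display} {T : measurableType d} {R : realType}.
Context (P : probability T R) {m n : nat}.
Context (I : nat -> T -> {set 'I_m}) (J : nat -> T -> {set 'I_n}).

Definition selections k w := mkseq (fun i => (I i w, J i w)) k.

(** The default of [nth] is never reached below: [selection_times (size h)] stops before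
    [size h]. *)
Definition history_event h (i : nat + nat) : set T :=
  match i with
  | inl i => I i @^-1` [set (nth (finset.set0, finset.set0) h i).1]
  | inr i => J i @^-1` [set (nth (finset.set0, finset.set0) h i).2]
  end.

Definition selection_times k : seq (nat + nat) :=
  map inl (iota 0 k) ++ map inr (iota 0 k).

Lemma selections_preimage h : selections (size h) @^-1` [set h] =
  \bigcap_(i in [set` selection_times (size h)]) history_event h i.
Proof.
apply/seteqP; split => w /=.
  move=> wh i; rewrite /= mem_cat => /orP[] /mapP[l];
    rewrite mem_iota /= add0n => lh -> /=; by rewrite -wh nth_mkseq.
move=> wh; apply: (@eq_from_nth _ (finset.set0, finset.set0)).
  by rewrite size_mkseq.
move=> i; rewrite size_mkseq => ih; rewrite nth_mkseq//.
have := wh (inl i); have := wh (inr i); rewrite /selection_times /= !mem_cat.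
rewrite !mem_map ?mem_iota ?ih ?orbT; try by move=> ? ? [].
by move=> /(_ isT) -> /(_ isT) ->; rewrite -surjective_pairing.
Qed.

Lemma selections_measurable h :
  (forall i S, measurable (I i @^-1` [set S])) ->
  (forall i S, measurable (J i @^-1` [set S])) ->
  measurable (selections (size h) @^-1` [set h]).
Proof.
move=> mI mJ; rewrite selections_preimage.
apply: fin_bigcap_measurable => // -[i|i] _; [exact: mI|exact: mJ].
Qed.

(** Independence factors the probability over all row and column draws, and [big_split] pairs the
    factors by time. *)
Lemma selections_prob h (wI : {set 'I_m} -> R) (wJ : {set 'I_n} -> R) :
  mutually_independent P (selection_events I J) ->
  (forall i S, P (I i @^-1` [set S]) = (wI S)%:E) ->
  (forall i S, P (J i @^-1` [set S]) = (wJ S)%:E) ->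
  P (selections (size h) @^-1` [set h]) = (\prod_(s <- h) (wI s.1 * wJ s.2))%:E.
Proof.
move=> ind PI PJ; rewrite selections_preimage ind; last 2 first.
- rewrite cat_uniq !map_inj_uniq ?iota_uniq ?andbT; try by move=> ? ? [].
  by apply/hasPn => _ /mapP[i _ ->]; apply/negP => /mapP[].
- move=> [i|i] _ /=; by eexists; [|reflexivity].
rewrite big_cat !big_map /= -big_split /=.
under eq_bigr do rewrite PI PJ.
rewrite [in RHS](big_nth (finset.set0, finset.set0)) prodEFin.
by rewrite /index_iota subn0.
Qed.

End Selections.

(** * The minimal norm solution and the error of the iterates *)

Section ErrorRecursion.
Context {R : realType} {m p q n : nat}.
Context (A : 'M[R]_(m, p)) (B : 'M[R]_(q, n)).

Lemma mpinv_solution C : (exists X, A *m X *m B = C) ->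
  A *m (mpinv A *m C *m mpinv B) *m B = C.
Proof.
have [AKA _ _ _] := mpinvP A; have [BLB _ _ _] := mpinvP B.
move=> [X <-]; rewrite !mulmxA AKA -(mulmxA (A *m X) B) -(mulmxA (A *m X)).
by rewrite BLB.
Qed.

(** The Penrose equations give A^+ = A^+ A A^+ = A^T (A^+)^T A^+, and similarly for B^+ on the
    right. *)
Lemma mpinv_solution_range C : exists W,
  mpinv A *m C *m mpinv B = A^T *m W *m B^T.
Proof.
have [_ KAK _ KAt] := mpinvP A; have [_ LBL BLt _] := mpinvP B.
rewrite -KAK -LBL -(mulmxA _ B) -{1}KAt.
exists ((mpinv A)^T *m mpinv A *m C *m mpinv B *m (mpinv B)^T).
have -> : B *m mpinv B = (mpinv B)^T *m B^T by rewrite -BLt trmx_mul.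
by rewrite trmx_mul !mulmxA.
Qed.

(** As [Xs] solves the equation, C_{I,J} = A_I Xs B_J, so the residual depends on the error
    alone. *)
Lemma grbk_error C (Xs : 'M[R]_(p, q)) X0 I J k : A *m Xs *m B = C ->
  grbk A B C X0 I J k - Xs =
  foldl (error_step A B) (X0 - Xs) (mkseq (fun i => (I i, J i)) k).
Proof.
move=> AXB; elim: k => [//|k IH]; rewrite mkseqS foldl_rcons -IH /=.
set X := grbk _ _ _ _ _ _ _; rewrite /error_step /=.
have -> : rowscols C (I k) (J k) = rows A (I k) *m Xs *m cols B (J k).
  by rewrite -AXB /rowscols /rows /cols mul_rowsub_mx -mxsub_mul.
rewrite -mulmxBl -mulmxBr -[Xs - X]opprB mulmxN mulNmx mulmxN mulNmx.
by rewrite addrAC !mulmxA.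
Qed.

End ErrorRecursion.

(** * The convergence estimate *)

Unset Implicit Arguments.

(** [hX0] places the initial error among the matrices A^T W B^T, where [sigma_min] gives lower
    bounds; [hF] and [hG] supply the covering that compares sampled blocks with the whole
    matrices. *)
Theorem theorem2p1 (R : realType) (m p q n : nat)
  (A : 'M[R]_(m, p)) (B : 'M[R]_(q, n)) (C : 'M[R]_(m, n))
  (hsol : exists X : 'M[R]_(p, q), A *m X *m B = C)
  (X0 : 'M[R]_(p, q))
  (hX0 : exists W : 'M[R]_(m, n), X0 = A^T *m W *m B^T)
  (F : {set {set 'I_m}}) (prI : {set 'I_m} -> R) (hI : sampling F prI)
  (G : {set {set 'I_n}}) (prJ : {set 'I_n} -> R) (hJ : sampling G prJ)
  (hF : forall i : 'I_m, exists2 S, S \in F & i \in S)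
  (hG : forall j : 'I_n, exists2 S, S \in G & j \in S)
  (d : measure_display) (T : measurableType d) (P : probability T R)
  (I : nat -> T -> {set 'I_m}) (J : nat -> T -> {set 'I_n})
  (lawI : forall k, has_law P (I k) F prI)
  (lawJ : forall k, has_law P (J k) G prJ)
  (hind : mutually_independent P (selection_events I J))
  (k : nat) :
  let Xs : 'M[R]_(p, q) := mpinv A *m C *m mpinv B in
  ('E_P[fun w => (frob_norm (grbk A B C X0 (I^~ w) (J^~ w) k - Xs) ^+ 2)%R]
   <= ((1 - sigma_min (Delta A F prI) ^+ 2 * sigma_min (Gamma B G prJ) ^+ 2
          * sigma_min A ^+ 2 * sigma_min B ^+ 2) ^+ k
       * frob_norm (X0 - Xs) ^+ 2)%:E)%E.
Proof.
set Xs := mpinv A *m C *m mpinv B; cbv zeta.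
rewrite -/(rate A B F G prI prJ); set rho := rate _ _ _ _ _ _.
have solXs : A *m Xs *m B = C by exact: mpinv_solution.
pose good (E : 'M[R]_(p, q)) := exists W, E = A^T *m W *m B^T.
have goodE : good (X0 - Xs).
  have [W0 ->] := hX0; have [W XsE] := mpinv_solution_range A B C.
  by exists (W0 - W); rewrite /Xs XsE -mulmxBl -mulmxBr.
have good_step E s : good E -> good (error_step A B E s).
  by move=> [W ->]; exact: error_step_range.
(* Extending the probabilities by 0 lets histories range over all pairs of index sets. *)
pose w1 (S : {set 'I_m}) := if S \in F then prI S else 0.
pose w2 (S : {set 'I_n}) := if S \in G then prJ S else 0.
pose w (s : {set 'I_m} * {set 'I_n}) := w1 s.1 * w2 s.2.
have w_ge0 s : 0 <= w s.
  by rewrite /w /w1 /w2 mulr_ge0//; case: ifP => // ?; apply: ltW;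
    [exact: hI.1|exact: hJ.1].
have contr E : good E ->
    \sum_s w s * sqnorm (error_step A B E s) <= (1 - rho) * sqnorm E.
  move=> [W ->]; apply: (le_trans _ (expected_error_step A B W hI hJ hF hG)).
  rewrite le_eqVlt; apply/orP; left; apply/eqP.
  transitivity (\sum_S \sum_S' w (S, S') *
      sqnorm (error_step A B (A^T *m W *m B^T) (S, S'))).
    by rewrite pair_bigA; apply: eq_bigr => -[].
  rewrite [RHS]big_mkcond; apply: eq_bigr => S _; rewrite /w /w1 /=.
  case: ifP => _; last by rewrite big1// => S' _; rewrite !mul0r.
  rewrite [RHS]big_mkcond; apply: eq_bigr => S' _; rewrite /w2.
  by case: ifP => // _; rewrite mulr0 mul0r.
under eq_fun do rewrite sqr_frob_norm (grbk_error _ _ _ _ solXs).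
rewrite sqr_frob_norm.
rewrite (@expectation_finite _ _ _ P _ (selections I J k) (histories k)
  (fun h => sqnorm (foldl (error_step A B) (X0 - Xs) h))); last 4 first.
- exact: histories_uniq.
- by move=> w'; exact: mem_histories.
- move=> h /size_histories <-; apply: selections_measurable => i S.
    by have [+ _] := lawI i; exact.
  by have [+ _] := lawJ i; exact.
- by move=> h; exact: sqnorm_ge0.
have -> : (\sum_(h <- histories k)
    (sqnorm (foldl (error_step A B) (X0 - Xs) h))%:E *
      P (selections I J k @^-1` [set h]) =
    (\sum_(h <- histories k) (\prod_(s <- h) w s) *
      sqnorm (foldl (error_step A B) (X0 - Xs) h))%:E)%E.
  rewrite -sumEFin; apply: eq_big_seq => h /size_histories hk.
  rewrite -{1}hk (@selections_prob _ _ _ P _ _ I J h w1 w2 hind).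
  - by rewrite -EFinM mulrC.
  - by move=> i S; rewrite (has_law_weight hI (lawI i)).
  - by move=> i S; rewrite (has_law_weight hJ (lawJ i)).
rewrite lee_fin.
(* Iterating the one-step bound multiplies inequalities by [1 - rho], so its sign matters. *)
have [rho1|rho1] := leP 0 (1 - rho).
  exact: (sum_histories_contraction (good := good)).
(* A negative rate forces the initial error to vanish, hence all later ones. *)
have E0 : X0 - Xs = 0.
  apply: sqnorm_eq0; apply/eqP; rewrite eq_le sqnorm_ge0 andbT.
  have := contr _ goodE.
  have sum_ge0 : 0 <= \sum_s w s * sqnorm (error_step A B (X0 - Xs) s).
    by apply: sumr_ge0 => s _; rewrite mulr_ge0// sqnorm_ge0.
  by move=> /(le_trans sum_ge0); rewrite nmulr_rge0.
rewrite E0 sqnorm0 mulr0 big1// => h _.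
have -> : foldl (error_step A B) 0 h = 0.
  elim: h => //= s h IH; rewrite -[RHS]IH; congr foldl.
  by rewrite /error_step mulmx0 mul0mx subr0.
by rewrite sqnorm0 mulr0.
Qed.
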